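(* Let $N$ be a positive integer and $a\in\{1,2,\ldots,N\}$. For formal variables $u,v,w$, $$\sum_{k\geq n+s,\ n\geq s\geq 1}G_{0,N,a}(k,n,s)\,u^{k-n-s}v^{n-s}w^{s-1}=\frac{1}{a(a-u)}\;{}_3F_2\!\left(\begin{matrix}\alpha,\ \beta,\ 1\\ \frac{a+N}{N},\ \frac{a+N-u}{N}\end{matrix};1\right),$$ where $\alpha,\beta$ are determined by $\alpha+\beta=\frac1N(2a-u+v)$ and $\alpha\beta=\frac1{N^2}\bigl(a(a-u+v)-uv+w\bigr)$.
   Context: An index is a finite sequence $\mathbf{k}=(k_1,\ldots,k_n)$ of positive integers; its weight is $k_1+\cdots+k_n$, its depth is $n$, and its height is the number of $j$ with $k_j\geq 2$. It is admissible if $k_1>1$. For an admissible index, $$t_{N,a}(k_1,\ldots,k_n)=\sum_{m_1>\cdots>m_n>0,\ m_i\equiv a\ (\mathrm{mod}\ N)}\frac{1}{m_1^{k_1}\cdots m_n^{k_n}}.$$ $I_0(k,n,s)$ is the set of admissible indices of weight $k$, depth $n$ and height $s$, and $G_{0,N,a}(k,n,s)=\sum_{\mathbf{k}\in I_0(k,n,s)}t_{N,a}(\mathbf{k})$. The generalized hypergeometric function is $${}_{m+1}F_m\!\left(\begin{matrix}b_1,\ldots,b_{m+1}\\ c_1,\ldots,c_m\end{matrix};z\right)=\sum_{j=0}^\infty\frac{(b_1)_j\cdots(b_{m+1})_j}{(c_1)_j\cdots(c_m)_j}\frac{z^j}{j!},$$ with $(b)_0=1$, $(b)_j=b(b+1)\cdots(b+j-1)$.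 The identity is one of formal power series in $u,v,w$: each term of the hypergeometric series (which depends on $\alpha,\beta$ only through $\alpha+\beta$ and $\alpha\beta$) is expanded as a power series in $u,v,w$ and the series is summed coefficientwise. *)

(* Defs.v *)
From HB Require Import structures.
From mathcomp Require Import all_boot all_order all_algebra qpoly.
From mathcomp Require Import all_classical all_reals all_analysis.
From mathcomp Require Import ring.

Set Implicit Arguments.
Unset Strict Implicit.
Unset Printing Implicit Defensive.

Import Order.TTheory GRing.Theory Num.Theory.
Import numFieldNormedType.Exports.
Local Open Scope classical_set_scope.
Local Open Scope ring_scope.

(* Every commutative ring becomes a comUnitRingType, the units being the
   elements that have an inverse. *)
Section ClassicalUnits.
Context {A : comNzRingType}.

Definition cunit : pred A := fun x => `[< exists y : A, y * x = 1 >].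

Definition cinv (x : A) : A := xget x [set y | y * x = 1].

Lemma cmulVr : {in cunit, left_inverse 1 cinv *%R}.
Proof.
by move=> x /asboolP[y yx]; rewrite /cinv; case: xgetP => [z _ //|/(_ y)].
Qed.

Lemma cunitPl (x y : A) : y * x = 1 -> cunit x.
Proof. by move=> yx; apply/asboolP; exists y. Qed.

Lemma cinv_out : {in [predC cunit], cinv =1 id}.
Proof.
move=> x /negP nx; rewrite /cinv; case: xgetP => // y _ yx.
by exfalso; apply: nx; apply: cunitPl yx.
Qed.
End ClassicalUnits.

Record fps (R : Type) := FPS { fcoef :> nat -> R }.

HB.instance Definition _ (R : Type) := gen_eqMixin (fps R).
HB.instance Definition _ (R : Type) := gen_choiceMixin (fps R).

Lemma fpsP (R : Type) (f g : fps R) : f =1 g -> f = g.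
Proof. by case: f g => [f] [g] /= /funext ->. Qed.

Section FpsRing.
Context {R : comNzRingType}.
Implicit Types f g h : fps R.

Definition fps0 : fps R := FPS (fun=> 0).
Definition fpsN f : fps R := FPS (fun n => - f n).
Definition fpsD f g : fps R := FPS (fun n => f n + g n).

Definition fpsC (c : R) : fps R := FPS (fun n => if n == 0%N then c else 0).
Definition fpsX : fps R := FPS (fun n => if n == 1%N then 1 else 0).
Definition fpsM f g : fps R := FPS (fun n => \sum_(i < n.+1) f i * g (n - i)%N).

Lemma fpsDA : associative fpsD.
Proof. by move=> f g h; apply: fpsP => n /=; rewrite addrA. Qed.
Lemma fpsDC : commutative fpsD.
Proof. by move=> f g; apply: fpsP => n /=; rewrite addrC. Qed.
Lemma fps0D : left_id fps0 fpsD.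
Proof. by move=> f; apply: fpsP => n /=; rewrite add0r. Qed.
Lemma fpsND : left_inverse fps0 fpsN fpsD.
Proof. by move=> f; apply: fpsP => n /=; rewrite addNr. Qed.

HB.instance Definition _ := GRing.isZmodule.Build (fps R) fpsDA fpsDC fps0D fpsND.

Definition fps_trunc n f : {poly R} := \poly_(i < n.+1) f i.

Lemma coef_trunc n f i : (i <= n)%N -> (fps_trunc n f)`_i = f i.
Proof. by move=> le_in; rewrite coef_poly ltnS le_in. Qed.

Lemma coef_truncM n f g i : (i <= n)%N ->
  (fps_trunc n f * fps_trunc n g)`_i = fpsM f g i.
Proof.
move=> le_in; rewrite coefM; apply: eq_bigr => j _.
rewrite !coef_trunc ?(leq_trans (leq_subr _ _)) //.
by apply: leq_trans le_in; rewrite -ltnS.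
Qed.

Lemma fpsMA : associative fpsM.
Proof.
move=> f g h; apply: fpsP => n.
transitivity ((fps_trunc n f * (fps_trunc n g * fps_trunc n h))`_n).
  rewrite coefM; apply: eq_bigr => j _.
  by rewrite coef_trunc -1?ltnS // coef_truncM // leq_subr.
rewrite mulrA coefM; apply: eq_bigr => j _.
by rewrite coef_truncM -1?ltnS // coef_trunc // leq_subr.
Qed.

Lemma fpsMC : commutative fpsM.
Proof. by move=> f g; apply: fpsP => n; rewrite -!(@coef_truncM n) // mulrC. Qed.

Lemma fps1M : left_id (fpsC 1) fpsM.
Proof.
move=> f; apply: fpsP => n /=; rewrite big_ord_recl /= mul1r subn0.
by rewrite big1 ?addr0 // => i _; rewrite mul0r.
Qed.

Lemma fpsMDl : left_distributive fpsM fpsD.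
Proof.
move=> f g h; apply: fpsP => n /=; rewrite -big_split /=.
by apply: eq_bigr => i _; rewrite mulrDl.
Qed.

Lemma fps1_neq0 : fpsC 1 != 0 :> fps R.
Proof. by apply/eqP => /(congr1 (fun f => f 0%N))/eqP; rewrite oner_eq0. Qed.

HB.instance Definition _ := GRing.Zmodule_isComNzRing.Build (fps R)
  fpsMA fpsMC fps1M fpsMDl fps1_neq0.

HB.instance Definition _ := GRing.ComNzRing_hasMulInverse.Build (fps R)
  cmulVr cunitPl cinv_out.
End FpsRing.

(* Power series in u, v, w: the coefficient of u^p v^q w^r in f is f p q r. *)
Notation fps3 R := (fps (fps (fps R))).

Section Fps3.
Context {R : comNzRingType}.

Definition cst3 (c : R) : fps3 R := fpsC (fpsC (fpsC c)).
Definition fpsU : fps3 R := fpsX.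
Definition fpsV : fps3 R := fpsC fpsX.
Definition fpsW : fps3 R := fpsC (fpsC fpsX).
End Fps3.

(* The series of formal power series with terms F j has sum f, each coefficient
   being summed separately in R. *)
Definition coefwise_sum {R : realType} (F : nat -> fps3 R) (f : fps3 R) : Prop :=
  forall p q r : nat, (\sum_(j < n) F j p q r) @[n --> \oo] --> f p q r.

Section Indices.
Implicit Types ks : seq nat.

Definition is_index ks : bool := all (leq 1) ks.
Definition weight ks : nat := sumn ks.
Definition depth ks : nat := size ks.
Definition height ks : nat := count (leq 2) ks.
Definition admissible ks : bool := is_index ks && (1 < head 0 ks)%N.

Definition I0 (k n s : nat) : set (seq nat) :=
  [set ks | [/\ admissible ks, weight ks = k, depth ks = n & height ks = s]].
End Indices.

Section TValues.
Context {R : realType}.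

(* The tuples m_1 > ... > m_n > 0 with m_i = a mod N, as sequences. *)
Definition t_range (N a n : nat) : set (seq nat) :=
  [set ms | [/\ size ms = n, sorted gtn ms, all (leq 1) ms
              & all (fun m => m == a %[mod N]) ms]].

Definition t_term (ks ms : seq nat) : R :=
  \prod_(mk <- zip ms ks) (mk.1%:R ^+ mk.2)^-1.

(* For an admissible ks the sum is finite, so that fine loses nothing. *)
Definition t_value (N a : nat) (ks : seq nat) : R :=
  fine (\esum_(ms in t_range N a (depth ks)) (t_term ks ms)%:E).

Definition G0 (N a k n s : nat) : R := \sum_(ks \in I0 k n s) t_value N a ks.

(* The weight k part of the generating function.  The coefficient of
   u^p v^q w^r in the full sum comes from the weight p + q + 2 r + 2 only. *)
Definition genfun_wt (N a k : nat) : fps3 R :=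
  \sum_(1 <= s < k.+1) \sum_(s <= n < k.+1 | (n + s <= k)%N)
    cst3 (G0 N a k n s)
      * fpsU ^+ (k - n - s) * fpsV ^+ (n - s) * fpsW ^+ (s - 1).
End TValues.

Section Hypergeometric.
Context {A : comUnitRingType}.

Definition poch (b : A) (j : nat) : A := \prod_(i < j) (b + i%:R).

Definition hyper_term (bs cs : seq A) (z : A) (j : nat) : A :=
  (\prod_(b <- bs) poch b j) / (\prod_(c <- cs) poch c j) * (z ^+ j / j`!%:R).
End Hypergeometric.

Definition cring (A : comNzRingType) : Type := A.
HB.instance Definition _ (A : comNzRingType) := GRing.ComNzRing.on (cring A).
HB.instance Definition _ (A : comNzRingType) :=
  GRing.ComNzRing_hasMulInverse.Build (cring A) cmulVr cunitPl cinv_out.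

(* alpha and beta are in general not power series: they live in an extension of
   the ring of power series, and such an extension always exists, namely
   A = B[X]/(X^2 - s X + t) with alpha the class of X. *)
Lemma sum_prod_extension (B : comNzRingType) (s t : B) :
  exists (A : comUnitRingType) (iota : {rmorphism B -> A}) (alpha beta : A),
    [/\ injective iota, alpha + beta = iota s & alpha * beta = iota t].
Proof.
pose h : {poly B} := 'X^2 - (s *: 'X - t%:P).
have szl : (size (s *: 'X - t%:P : {poly B})%R < size ('X^2 : {poly B})%R)%N.
  rewrite size_polyXn; apply: leq_ltn_trans (size_polyD _ _) _.
  rewrite gtn_max size_polyN; apply/andP; split.
    by apply: leq_ltn_trans (size_scale_leq _ _) _; rewrite size_polyX.
  by apply: leq_ltn_trans (size_polyC_leq1 _) _.
have szh : size h = 3 by rewrite size_polyDl ?size_polyXn ?size_polyN //; move: szl; rewrite size_polyXn.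
have hmon : h \is monic.
  by rewrite monicE lead_coefDl ?lead_coefXn ?size_polyN.
have mkh : mk_monic h = h by rewrite /mk_monic szh hmon.
pose f : {rmorphism B -> {poly %/ h}} := (in_qpoly h \o polyC).
have hK : in_qpoly h h = 0.
  by apply: val_inj; rewrite /= mkh (Pdiv.RingMonic.rmodpp hmon).
exists (cring {poly %/ h}), f, (in_qpoly h 'X), (in_qpoly h (s%:P - 'X)); split.
- move=> x y /(congr1 val) /=.
  rewrite mkh !Pdiv.Ring.rmodp_small ?szh.
  + exact: polyC_inj.
  + by rewrite (leq_ltn_trans (size_polyC_leq1 _)).
  + by rewrite (leq_ltn_trans (size_polyC_leq1 _)).
- by rewrite -[LHS](raddfD (in_qpoly h)) addrCA subrr addr0.
- rewrite -[LHS](rmorphM (in_qpoly h)).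
  have -> : 'X * (s%:P - 'X) = t%:P - h :> {poly B}.
    by rewrite /h -mul_polyC; ring.
  by rewrite raddfB /= hK subr0.
Qed.

(* Main.v *)
From HB Require Import structures.
Require Import Defs.
From mathcomp Require Import all_boot all_order all_algebra.
From mathcomp Require Import all_classical all_reals all_analysis.
From mathcomp Require Import ring lra zify.

Import Order.TTheory GRing.Theory Num.Theory.
Import numFieldNormedType.Exports.
Local Open Scope classical_set_scope.
Local Open Scope ring_scope.

Set Implicit Arguments.
Unset Strict Implicit.
Unset Printing Implicit Defensive.

(** Each entry m of an index contributes v/m when it equals 1 and, summing over
    all values >= 2, w/(m(m-u)); the first entry contributes 1/(m(m-u)).  Hence
    the generating function is the sum over m_1 = a + N j of
      1/(m_1(m_1-u)) * prod_(m < m_1, m = a mod N) (1 + v/m + w/(m(m-u))),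
    and since 1 + v/m + w/(m(m-u)) = (m(m-u) + v(m-u) + w)/(m(m-u)), whose
    numerator at m = a + N l is N^2 (l + alpha)(l + beta), the j-th summand is
    1/(a(a-u)) times the j-th term of the hypergeometric series.  Convergence of
    the multiple sums follows from a telescoping bound. *)

(** * Unordered sums of nonnegative terms as limits along exhausting lists *)

Lemma cvg_esum_seq (R : realType) (T : choiceType) (D : set T) (f : T -> R)
    (s : nat -> seq T) (M : R) :
    (forall x, 0 <= f x) -> (forall J, uniq (s J)) ->
    (forall J, {subset s J <= s J.+1}) ->
    (forall x, D x <-> exists J, x \in s J) ->
    (forall J, \sum_(x <- s J) f x <= M) ->
  \sum_(x <- s J) f x @[J --> \oo] --> fine (\esum_(x in D) (f x)%:E).
Proof.
move=> f0 us sS Ds fM.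
have smono : {homo s : i j / (i <= j)%N >-> {subset i <= j}}.
  move=> i j /subnKC <-; elim: (j - i)%N => [|k IH x /IH]; first by rewrite addn0.
  by rewrite addnS; apply: sS.
have fsE J : (\sum_(x \in [set` s J]) (f x)%:E = (\sum_(x <- s J) f x)%:E)%E.
  by rewrite -fsbig_seq // sumEFin.
have mono : {homo (fun J => \sum_(x <- s J) f x) : i j / (i <= j)%N >-> i <= j}.
  move=> i j ij; rewrite -lee_fin -!fsE.
  apply: lee_fsum_nneg_subset; try exact: finite_seq.
    by move=> x; rewrite !inE; apply: smono ij x.
  by move=> x _; rewrite lee_fin.
have := nondecreasing_cvgn mono.
set l := sup _ => /(_ _) cl.
have {}cl : \sum_(x <- s J) f x @[J --> \oo] --> l.
  by apply: cl; exists M => _ [J _ <-].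
suff -> : (\esum_(x in D) (f x)%:E = l%:E)%E by [].
have le_l J : \sum_(x <- s J) f x <= l.
  rewrite -(cvg_lim _ cl)//; apply: nondecreasing_cvgn_le => //.
  by apply/cvg_ex; exists l.
(* A finite subset of [D] lies in some [s J] because the lists increase, which gives one inequality;
   each [s J] is itself a finite subset of [D], which gives the other. *)
apply/eqP; rewrite eq_le; apply/andP; split.
  apply: ge_ereal_sup => _ [X [Xfin XD] <-].
  have [J XJ] : exists J, X `<=` [set` s J].
    have /finite_seqP[xs Xxs] := Xfin.
    move: XD; rewrite {}Xxs {Xfin}; elim: xs => [_|x xs IH xsD].
      by exists 0%N => x.
    have [|J1 xsJ1] := IH; first by move=> y yxs; apply: xsD; rewrite /= inE yxs orbT.
    have [|J2 xJ2] := (Ds x).1; first by apply: xsD; rewrite /= inE eqxx.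
    exists (maxn J1 J2) => y /=; rewrite inE => /orP[/eqP ->|/xsJ1].
      exact: smono (leq_maxr _ _) _ xJ2.
    by apply: smono; rewrite leq_maxl.
  apply: (@le_trans _ _ (\sum_(x <- s J) f x)%:E); last by rewrite lee_fin.
  rewrite -fsE; apply: lee_fsum_nneg_subset => //.
    by move=> x; rewrite !inE; apply: XJ.
  by move=> x _; rewrite lee_fin.
have : (\sum_(x <- s J) f x)%:E @[J --> \oo] --> l%:E.
  by apply: cvg_comp cl _; exact: cvg_id.
move=> cl'; rewrite -(cvg_lim _ cl')//; apply: lime_le; first by apply/cvg_ex; exists l%:E.
apply: nearW => J; apply: esum_ge; exists [set` s J]; last by rewrite fsE.
by split; [exact: finite_seq|move=> x /= xJ; apply/Ds; exists J].
Qed.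

(** * Truncated multiple sums, and their convergence to the values [t_value] *)

Section TruncatedSums.
Context {R : realType} (N a : nat).
Implicit Types ks ms : seq nat.

Definition ap (j : nat) : nat := (a + N * j)%N.

(** The summation tuples with all entries below [ap J]. Splitting on whether the largest available
    number is used as m_1 makes every truncated sum satisfy a recursion in [J]. *)
Fixpoint chains (J n : nat) : seq (seq nat) :=
  match J, n with
  | _, 0 => [:: [::]]
  | 0, _.+1 => [::]
  | J'.+1, n'.+1 => chains J' n ++ [seq ap J' :: ms | ms <- chains J' n']
  end.

Definition zsum (J : nat) ks : R := \sum_(ms <- chains J (size ks)) t_term ks ms.

Lemma zsum_nil J : zsum J [::] = 1.
Proof. by case: J => *; rewrite /zsum big_seq1 /t_term /= big_nil. Qed.

Lemma zsum0_cons k ks : zsum 0 (k :: ks) = 0.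
Proof. by rewrite /zsum big_nil. Qed.

Lemma zsumS J k ks :
  zsum J.+1 (k :: ks) = zsum J (k :: ks) + (ap J)%:R^-1 ^+ k * zsum J ks.
Proof.
rewrite /zsum /= big_cat big_map /=; congr (_ + _).
by rewrite mulr_sumr; apply: eq_bigr => ms _; rewrite /t_term /= big_cons /= exprVn.
Qed.

Lemma t_term_ge0 ks ms : 0 <= t_term ks ms :> R.
Proof. by apply: prodr_ge0 => i _; rewrite invr_ge0 exprn_ge0. Qed.

Hypotheses (a_ge1 : (1 <= a)%N) (a_leN : (a <= N)%N).

Let N_gt0 : (0 < N)%N. Proof. exact: leq_trans a_leN. Qed.

Lemma ap_inj : injective ap.
Proof. by move=> i j /addnI/eqP; rewrite eqn_pmul2l // => /eqP. Qed.

Lemma ltn_ap i j : (ap i < ap j)%N = (i < j)%N.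
Proof. by rewrite ltn_add2l ltn_pmul2l. Qed.

(** As 1 <= a <= N, the number a is the least positive element of its residue class. *)
Lemma apP m : reflect (exists j, m = ap j) ((1 <= m)%N && (m == a %[mod N])).
Proof.
apply: (iffP andP) => [[m1 /eqP ma]|[j ->]]; last first.
  by split; rewrite /ap ?addn_gt0 ?a_ge1 // addnC mulnC modnMDl.
have am : (a <= m)%N.
  rewrite leqNgt; apply/negP => lt_ma; move: ma.
  rewrite modn_small ?(leq_trans lt_ma) //.
  (* When a = N the residue is 0, and m < N would force m = 0. *)
  move: a_leN; rewrite leq_eqVlt => /orP[/eqP ->|aN].
    by rewrite modnn => m0; rewrite m0 in m1.
  by rewrite modn_small // => ma; rewrite ma ltnn in lt_ma.
have /dvdnP[j mj] : (N %| m - a)%N by rewrite -eqn_mod_dvd // ma.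
by exists j; rewrite /ap mulnC -mj subnKC.
Qed.

Lemma mem_chains J n ms : (ms \in chains J n) =
  [&& size ms == n, sorted gtn ms, all (leq 1) ms,
      all (fun m => m == a %[mod N]) ms & all (gtn (ap J)) ms].
Proof.
have gt_trans : transitive gtn by move=> x y z /= xy /ltn_trans; apply.
elim: J n ms => [|J IH] [|n] [|m ms] //=.
- apply/esym/negP => /and5P[_ _ /andP[m1 _] /andP[ma _] /andP[]].
  have /apP[j ->] : (1 <= m)%N && (m == a %[mod N]) by rewrite m1.
  by rewrite ltn_ap.
- by rewrite mem_cat IH /=; apply/negP => /mapP[].
rewrite mem_cat IH /= eqSS (path_sortedE gt_trans).
have [/apP[j mj]|nm] := boolP ((1 <= m)%N && (m == a %[mod N])); last first.
  transitivity false.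
    apply/negP => /orP[/and5P[_ _ /andP[m1 _] /andP[m2 _] _]|/mapP[ms' _ [mJ _]]].
      by rewrite m1 m2 in nm.
    by move/apP: nm; apply; exists J.
  by apply/esym/negP => /and5P[_ _ /andP[m1 _] /andP[m2 _] _]; rewrite m1 m2 in nm.
have [-> ->] : (1 <= m)%N /\ m == a %[mod N] by apply/andP/apP; exists j.
rewrite /= mj !ltn_ap ltnS [(j <= J)%N]leq_eqVlt.
have [->|neq] := eqVneq j J; last first.
  rewrite /=; case: ltnP => ltj /=.
    rewrite [X in _ || X](_ : _ = false) ?orbF; last first.
      by apply/negP => /mapP[ms' _ [/ap_inj e _]]; rewrite e eqxx in neq.
    congr andb; apply: andb_id2l => /andP[gt_j _]; congr [&& _, _ & _].
    apply/allP/allP => H x xms; first by rewrite /= (ltn_trans (H x xms)) ?ltn_ap.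
    by rewrite /= (leq_trans (allP gt_j x xms)) // ltnW ?ltn_ap.
  rewrite !andbF /=; apply/negP => /mapP[ms' _ [/ap_inj e _]].
  by rewrite e eqxx in neq.
rewrite ltnn /= !andbF /= mem_map; last by move=> x y [].
have : all (gtn (ap J)) ms ==> all (gtn (ap J.+1)) ms.
  by apply/implyP; apply: sub_all => x /= xJ; rewrite (ltn_trans xJ) // ltn_ap.
by rewrite IH; case: (all (gtn (ap J)) ms) => /= [->|_]; rewrite ?andbF ?andbT.
Qed.

Lemma chains_uniq J n : uniq (chains J n).
Proof.
elim: J n => [|J IH] [|n] //=.
rewrite cat_uniq IH map_inj_uniq ?IH ?andbT //=; last by move=> x y [].
apply/hasPn => _ /mapP[ms _ ->]; rewrite mem_chains /= ltnn /=.
by rewrite !andbF.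
Qed.

Lemma t_rangeP n ms : t_range N a n ms <-> exists J, ms \in chains J n.
Proof.
split=> [[sz srt m1 ma]|[J]].
  (* Every entry is at most [sumn ms], which is less than a + N * [sumn ms]. *)
  exists (sumn ms); rewrite mem_chains sz eqxx srt m1 ma /=.
  apply/allP => m mms; have : (m <= sumn ms)%N.
    by elim: ms mms {sz srt m1 ma} => //= x ms IH; rewrite inE => /orP[/eqP ->|/IH]; lia.
  by rewrite /ap /=; nia.
by rewrite mem_chains => /and5P[/eqP ? ? ? ? _].
Qed.

(** Majorant for sums over arbitrary indices. It grows like J^(1/(2N)), so that the sum of
    [half_prod J] / m^2 converges; without the factor 2 the growth would be too fast when N = 1. *)
Definition half_prod (J : nat) : R := \prod_(l < J) (1 + (2 * (ap l)%:R)^-1).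

Lemma ap_ge1 j : 1 <= (ap j)%:R :> R.
Proof. by rewrite ler1n addn_gt0 a_ge1. Qed.

Lemma half_prod_ge1 J : 1 <= half_prod J.
Proof.
elim: J => [|J IH]; first by rewrite /half_prod big_ord0.
rewrite /half_prod big_ord_recr -/(half_prod J) /= mulr_ege1 // lerDl invr_ge0.
by rewrite mulr_ge0 // ler0n.
Qed.

Lemma zsum_ge0 J ks : 0 <= zsum J ks.
Proof. by apply: sumr_ge0 => ms _; apply: t_term_ge0. Qed.

(** A new largest entry m contributes at most 1/m = 2 * 1/(2m): the 2 goes into the power of 2, and
    1 + 1/(2m) is the next factor of [half_prod]. *)
Lemma zsum_le_half_prod J ks : is_index ks -> zsum J ks <= 2 ^+ size ks * half_prod J.
Proof.
elim: J ks => [|J IH] [|k ks] //=; rewrite ?zsum_nil ?zsum0_cons ?mul1r ?half_prod_ge1 //.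
  by move=> _; rewrite /half_prod big_ord0 mulr1 exprn_ge0.
move=> /andP[k1 iks]; rewrite zsumS.
have z1 : zsum J (k :: ks) <= 2 ^+ (size ks).+1 * half_prod J by apply: IH; rewrite /= k1.
have z2 := IH _ iks.
rewrite /half_prod big_ord_recr -/(half_prod J) /=.
have m1 := ap_ge1 J.
have m0 : (ap J)%:R != 0 :> R by rewrite gt_eqF // (lt_le_trans ltr01).
have mk : (ap J)%:R^-1 ^+ k <= (ap J)%:R^-1 :> R.
  by rewrite -[leRHS]expr1 ler_wiXn2l ?invr_ge0 ?ler0n // invf_le1 // (lt_le_trans ltr01).
apply: (@le_trans _ _ (2 ^+ (size ks).+1 * half_prod J
                       + (ap J)%:R^-1 * (2 ^+ size ks * half_prod J))).
  apply: lerD => //; apply: ler_pM => //; exact: zsum_ge0.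
by rewrite le_eqVlt; apply/orP; left; apply/eqP; rewrite exprS; field.
Qed.

(* [half_prod J / ap J] decreases by [half_prod J * (N - 1/2) / (ap J * ap J.+1)], which
   dominates [half_prod J / (4 * ap J ^ 2)]: the sum telescopes. *)
Lemma zsum_bound ks J : admissible ks -> zsum J ks <= 2 ^+ (size ks).+1.
Proof.
case: ks => [|k ks]; rewrite /admissible ?andbF //= => /andP[/andP[_ iks] k2].
pose r J : R := half_prod J / (ap J)%:R.
have r_ge0 i : 0 <= r i.
  by rewrite divr_ge0 ?ler0n // (le_trans ler01) ?half_prod_ge1.
(* Since [r 0] = 1/a <= 1 and [r J] >= 0, the right side is at most 4 * 2 ^ [size ks], the announced
   bound. *)
suff H : zsum J (k :: ks) <= 2 ^+ size ks * (4 * (r 0%N - r J)).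
  apply: (le_trans H); rewrite mulrC !exprS mulrA -natrM ler_wpM2r ?exprn_ge0 //.
  rewrite ler_piMr // lerBlDr -[leLHS]addr0 lerD //.
  rewrite /r /half_prod big_ord0 mul1r invf_le1 ?ap_ge1 //.
  by rewrite (lt_le_trans ltr01) ?ap_ge1.
elim: J => [|J IH]; first by rewrite zsum0_cons subrr !mulr0.
rewrite zsumS.
have m1 := ap_ge1 J.
have m0 : 0 < (ap J)%:R :> R by rewrite (lt_le_trans ltr01).
have N1 : 1 <= N%:R :> R by rewrite ler1n.
(* Admissibility enters here: the first entry of the index is at least 2. *)
have mk : (ap J)%:R^-1 ^+ k <= (ap J)%:R^-1 ^+ 2 :> R.
  by rewrite ler_wiXn2l ?invr_ge0 ?ler0n // invf_le1.
have step : (ap J)%:R^-1 ^+ 2 * half_prod J <= 4 * (r J - r J.+1).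
  have -> : 4 * (r J - r J.+1) =
      (ap J)%:R^-1 ^+ 2 * half_prod J * ((4 * N%:R - 2) * (ap J)%:R / ((ap J)%:R + N%:R)).
    rewrite /r /half_prod big_ord_recr /= -/(half_prod J) [ap J.+1]/ap.
    rewrite mulnS addnCA [(N + _)%N]addnC.
    rewrite -/(ap J) natrD; field; rewrite gt_eqF //= ?gt_eqF //.
    by rewrite addr_gt0 // (lt_le_trans ltr01).
  rewrite ler_peMr ?mulr_ge0 ?exprn_ge0 ?invr_ge0 ?ler0n //.
    by rewrite (le_trans ler01) ?half_prod_ge1.
  rewrite ler_pdivlMr ?mul1r ?addr_gt0 ?(lt_le_trans ltr01) //.
  (* With m = [ap J], the claim m + N <= (4N - 2) m amounts to 3m(N - 1) + N(m - 1) >= 0. *)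
  nra.
apply: (@le_trans _ _ (2 ^+ size ks * (4 * (r 0%N - r J))
                       + 2 ^+ size ks * ((ap J)%:R^-1 ^+ 2 * half_prod J))).
  apply: lerD => //; rewrite mulrCA; apply: ler_pM => //; rewrite ?zsum_ge0 //.
  exact: zsum_le_half_prod.
rewrite -mulrDr ler_wpM2l ?exprn_ge0 //.
by apply: (le_trans (lerD (lexx _) step)); rewrite -mulrDr addrA subrK.
Qed.

Lemma cvg_zsum ks : admissible ks -> zsum J ks @[J --> \oo] --> t_value N a ks.
Proof.
move=> ks_adm; apply: cvg_esum_seq.
- exact: t_term_ge0.
- by move=> J; apply: chains_uniq.
- move=> J ms; case: (size ks) => [|n]; first by case: J.
  by rewrite [chains J.+1 _]/= mem_cat => ->.
- exact: t_rangeP.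
- by move=> J; apply: zsum_bound.
Qed.
End TruncatedSums.

(** * Enumeration of the indices by the exponents of u, v and w *)

Section IndexLists.
Implicit Types (ks : seq nat).

(** A head i + 2 carries u^i, so it takes i from the exponent [p] and leaves p - i to the tail. *)
Definition cons_ge2 (F : nat -> seq (seq nat)) (p : nat) : seq (seq nat) :=
  [seq i.+2 :: ks | i <- iota 0 p.+1, ks <- F (p - i)%N].

(** The parameters are the depth [n], the height [r] and p = weight - depth - height, the exponent
    of u. A head 1 changes neither [p] nor [r]. *)
Fixpoint indices (n p r : nat) : seq (seq nat) :=
  match n with
  | 0 => if (p == 0%N) && (r == 0%N) then [:: [::]] else [::]
  | n'.+1 => [seq 1%N :: ks | ks <- indices n' p r] ++
      (if r is r'.+1 then cons_ge2 (fun p => indices n' p r') p else [::])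
  end.

(** The exponents p = k - n - s, q = n - s and r = s - 1 mean depth q + r + 1 and height r + 1; the
    head accounts for one unit of each. *)
Definition admissible_indices (p q r : nat) : seq (seq nat) :=
  cons_ge2 (fun p => indices (q + r) p r) p.

Lemma mem_cons_ge2 F p k ks :
  (k :: ks \in cons_ge2 F p) = [&& 2 <= k, k <= p.+2 & ks \in F (p.+2 - k)]%N.
Proof.
apply/allpairsPdep/and3P => [[i [ks' []]]|[k2 kp ksF]].
  by rewrite mem_iota => ip ks'F [-> ->]; split=> //; lia.
exists (k - 2)%N, ks; rewrite mem_iota; split; try lia; last by congr cons; lia.
by move: ksF; congr (_ \in F _); lia.
Qed.

Lemma nil_cons_ge2 F p : [::] \notin cons_ge2 F p.
Proof. by apply/allpairsPdep => -[i [ks []]]. Qed.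

(** An entry is at least 1, and at least 2 if it counts for the height. Applied to a tail, this
    yields the bound on the head that [mem_cons_ge2] asks for. *)
Lemma size_height_le ks : is_index ks -> (size ks + height ks <= sumn ks)%N.
Proof.
elim: ks => //= k ks IH /andP[k1 /IH]; rewrite /height /=.
by case: (1 < k)%N / (ltnP 1 k); lia.
Qed.

Lemma mem_indices n p r ks : (ks \in indices n p r) =
  [&& is_index ks, size ks == n, height ks == r & sumn ks == p + n + r]%N.
Proof.
elim: n p r ks => [|n IH] p r [|k ks] /=.
- by case: p r => [|p] [|r].
- by rewrite andbF; case: ifP.
- rewrite mem_cat; apply/negP => /orP[/mapP[]//|]; case: r => // r.
  exact/negP/nil_cons_ge2.
rewrite mem_cat; set b := (X in X || _).
have -> : b = (k == 1%N) && (ks \in indices n p r).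
  rewrite /b; apply/mapP/andP => [[ks' h [-> ->]]|[/eqP -> h]]; first by rewrite eqxx.
  by exists ks.
have -> : (k :: ks \in if r is r'.+1 then cons_ge2 ((indices n)^~ r') p else [::]) =
    [&& 1 <= r, 2 <= k, k <= p.+2 & ks \in indices n (p.+2 - k) r.-1]%N.
  by case: r {b} => [|r] //; rewrite mem_cons_ge2.
rewrite !IH {b IH} eqSS.
rewrite -/(height ks).
have := @size_height_le ks; case: (is_index ks); rewrite ?andbF //=.
case: (size ks =P n) => [-> /(_ isT) le_s|_ _]; rewrite ?andbF ?andbT //=.
by apply/idP/idP; case: (ltnP 1 k); lia.
Qed.

Lemma mem_admissible_indices p q r ks :
  ks \in admissible_indices p q r <-> I0 (p + q + 2 * r + 2) (q + r + 1) (r + 1) ks.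
Proof.
rewrite /I0 /= /admissible /weight /depth /height.
case: ks => [|k ks]; first by rewrite (negPf (nil_cons_ge2 _ _)); split=> // -[].
rewrite mem_cons_ge2 mem_indices /height /=.
split=> [/and5P[k2 kp -> /eqP sz /andP[/eqP h /eqP s]]|[/andP[/andP[k1 ik] k2] sm sz h]].
  by split; lia.
by have := size_height_le ik; rewrite ik /height; lia.
Qed.

Lemma cons_ge2_uniq F p : (forall p, uniq (F p)) -> uniq (cons_ge2 F p).
Proof.
move=> uF; apply: allpairs_uniq_dep => [|i _|[i ks] [i' ks'] _ _ /= [-> ->]] //.
exact: iota_uniq.
Qed.

Lemma indices_uniq n p r : uniq (indices n p r).
Proof.
elim: n p r => [|n IH] p r /=; first by case: ifP.
rewrite cat_uniq map_inj_uniq ?IH; last by move=> x y [].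
case: r => [|r] //=; rewrite cons_ge2_uniq ?andbT; last by move=> p'; apply: IH.
by apply/hasPn => ks /allpairsPdep[i [ks' [_ _ ->]]]; apply/negP => /mapP[].
Qed.

Lemma G0E (R : realType) N a p q r :
  G0 N a (p + q + 2 * r + 2) (q + r + 1) (r + 1) =
  \sum_(ks <- admissible_indices p q r) t_value N a ks :> R.
Proof.
rewrite /G0 [in RHS]fsbig_seq; last by apply: cons_ge2_uniq => p'; apply: indices_uniq.
by congr (\sum_(_ \in _) _); apply/seteqP; split=> ks /mem_admissible_indices.
Qed.
End IndexLists.

(** * Coefficients of power series in one and in three variables *)

Section Coefficients.
Context {R : comNzRingType}.
Implicit Types f g : fps R.

Lemma fps_coef0 n : (0 : fps R) n = 0. Proof. by []. Qed.

Lemma fps_coefM f g n : (f * g) n = \sum_(i < n.+1) f i * g (n - i)%N.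
Proof. by []. Qed.

Lemma fps_coef_sum I (r : seq I) (P : pred I) (F : I -> fps R) n :
  (\sum_(i <- r | P i) F i) n = \sum_(i <- r | P i) F i n.
Proof. by apply: (big_morph (fun f : fps R => f n)). Qed.

Lemma fps_coefCM c f n : (fpsC c * f) n = c * f n.
Proof.
rewrite fps_coefM big_ord_recl /= subn0 big1 ?addr0 // => i _.
by rewrite mul0r.
Qed.

Lemma fps_coefMC c f n : (f * fpsC c) n = f n * c.
Proof. by rewrite mulrC fps_coefCM mulrC. Qed.

Lemma fps_coefXM f n : (fpsX * f) n = if n is m.+1 then f m else 0.
Proof.
rewrite fps_coefM big_ord_recl /= mul0r add0r; case: n => [|n]; first by rewrite big_ord0.
rewrite big_ord_recl /= mul1r subn1 big1 ?addr0 // => i _.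
by rewrite mul0r.
Qed.
End Coefficients.

(** Each coefficient of a product with [c] is a finite linear combination of coefficients of the
    other factor, so limits pass through. *)
Lemma coefwise_sumMl (R : realType) (c : fps3 R) F f :
  coefwise_sum F f -> coefwise_sum (fun j => c * F j) (c * f).
Proof.
move=> Ff p q r.
have {}Ff p' q' r' : (\sum_(j < n) F j) p' q' r' @[n --> \oo] --> f p' q' r'.
  by under eq_fun do rewrite !fps_coef_sum; apply: Ff.
have E (g : fps3 R) : (c * g) p q r = \sum_(i < p.+1) \sum_(j < q.+1) \sum_(k < r.+1)
    c i j k * g (p - i)%N (q - j)%N (r - k)%N.
  by rewrite fps_coefM !fps_coef_sum; apply: eq_bigr => i _;
    rewrite fps_coefM !fps_coef_sum; apply: eq_bigr => j _.
rewrite E; under eq_fun => n.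
  rewrite -!fps_coef_sum -mulr_sumr E; over.
by do 3!(apply: cvg_big => [|? _]; first exact: add_continuous); apply: cvgMl_tmp; apply: Ff.
Qed.

Section ConstantSeries.
Context {R : comNzRingType}.

Lemma fpsC_is_zmod_morphism : zmod_morphism (@fpsC R).
Proof. by move=> x y; apply: fpsP => -[|n] //=; rewrite subr0. Qed.

Lemma fpsC_is_monoid_morphism : monoid_morphism (@fpsC R).
Proof.
split=> // x y; apply: fpsP => n; rewrite fps_coefCM /=.
by case: eqP; rewrite ?mulr0.
Qed.

HB.instance Definition _ :=
  GRing.isZmodMorphism.Build R (fps R) (@fpsC R) fpsC_is_zmod_morphism.
HB.instance Definition _ :=
  GRing.isMonoidMorphism.Build R (fps R) (@fpsC R) fpsC_is_monoid_morphism.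

Lemma fpsC_exp (c : R) n : fpsC (c ^+ n) = fpsC c ^+ n.
Proof. exact: rmorphXn. Qed.

Lemma fps_coefXn i n : (fpsX ^+ i : fps R) n = (n == i)%:R.
Proof.
elim: i n => [|i IH] n; first by rewrite expr0; case: n.
by rewrite exprS fps_coefXM; case: n => [|n] //; rewrite IH.
Qed.
End ConstantSeries.

Section Coefficients3.
Context {R : comNzRingType}.
Implicit Types (f : fps3 R) (c : R).

Lemma coef_cst3M c f p q r : (cst3 c * f) p q r = c * f p q r.
Proof. by rewrite !fps_coefCM. Qed.

Lemma coef3D (f g : fps3 R) p q r : (f + g) p q r = f p q r + g p q r.
Proof. by []. Qed.

Lemma coef3B (f g : fps3 R) p q r : (f - g) p q r = f p q r - g p q r.
Proof. by []. Qed.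

Lemma coef3_1 p q r :
  (1 : fps3 R) p q r = if [&& p == 0%N, q == 0%N & r == 0%N] then 1 else 0.
Proof. by case: p q r => [|p] [|q] [|r]. Qed.

Lemma coef_UM f p q r : (fpsU * f) p q r = if p is p'.+1 then f p' q r else 0.
Proof. by rewrite fps_coefXM; case: p. Qed.

Lemma coef_cst3BUM c f p q r : ((cst3 c - fpsU) * f) p q r =
  c * f p q r - if p is p'.+1 then f p' q r else 0.
Proof.
rewrite mulrBl coef3B; congr (_ - _); first exact: coef_cst3M.
exact: coef_UM.
Qed.

Lemma coef_VM f p q r : (fpsV * f) p q r = if q is q'.+1 then f p q' r else 0.
Proof. by rewrite fps_coefCM fps_coefXM; case: q. Qed.

Lemma coef_WM f p q r : (fpsW * f) p q r = if r is r'.+1 then f p q r' else 0.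
Proof. by rewrite !fps_coefCM fps_coefXM; case: r. Qed.

(** Coefficient form of multiplication by one factor 1 + v/m + w/(m(m-u)), with c = 1/m and [g] =
    1/(m(m-u)) in the application. *)
Lemma coef_M1VW f g c p q r : (f * (1 + cst3 c * fpsV + fpsW * g)) p q r =
  f p q r + c * (if q is q'.+1 then f p q' r else 0)
    + (if r is r'.+1 then (g * f) p q r' else 0).
Proof.
have distr (S : comNzRingType) (e x v w h : S) :
  e * (1 + x * v + w * h) = e + x * (v * e) + w * (h * e) by ring.
rewrite distr 2!coef3D; congr (_ + _ + _); last exact: coef_WM.
by rewrite coef_cst3M; congr (_ * _); exact: coef_VM.
Qed.

Lemma coef_monomial c i j l p q r :
  (cst3 c * fpsU ^+ i * fpsV ^+ j * fpsW ^+ l) p q r =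
  if [&& p == i, q == j & r == l] then c else 0.
Proof.
(* Powers of v are constant in u, and powers of w are constant in u and v, so the coefficients can
   be read one level at a time. *)
have VW (f x y : fps3 R) X Y : x = fpsC X -> y = fpsC (fpsC Y) ->
    (f * x * y) p q r = ((f p * X) q * Y) r.
  by move=> -> ->; rewrite 3!fps_coefMC.
have XC (S : comNzRingType) (x : S) h n : (fpsC x * fpsX ^+ h) n = if n == h then x else 0.
  by rewrite fps_coefCM fps_coefXn; case: eqP; rewrite ?mulr1 ?mulr0.
apply: etrans (VW _ _ _ _ _ (esym (fpsC_exp fpsX j))
  (etrans (esym (fpsC_exp (fpsC fpsX) l)) (congr1 fpsC (esym (fpsC_exp fpsX l))))) _.
rewrite XC; case: (p == i); last by rewrite mul0r fps_coef0 mul0r.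
rewrite XC; case: (q == j); last by rewrite mul0r.
by rewrite XC.
Qed.

Lemma cst3_natr n : n%:R = cst3 n%:R :> fps3 R.
Proof. by rewrite /cst3 !rmorph_nat. Qed.

Definition FPS3 (F : nat -> nat -> nat -> R) : fps3 R :=
  FPS (fun p => FPS (fun q => FPS (fun r => F p q r))).

Lemma fps3P (f g : fps3 R) : (forall p q r, f p q r = g p q r) -> f = g.
Proof. by move=> fg; do 3!apply: fpsP => ?. Qed.
End Coefficients3.

Lemma natr_fps3_unit (R : realType) n : (0 < n)%N -> (n%:R : fps3 R) \is a GRing.unit.
Proof.
move=> n0; apply/unitrPr; exists (cst3 n%:R^-1).
by rewrite cst3_natr /cst3 -!rmorphM /= divff ?rmorph1 // pnatr_eq0 -lt0n.
Qed.

(** * The generating function as a sum of layers with fixed m_1 *)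

Section GeneratingFunction.
Context {R : realType} (N a : nat).

Local Notation m j := ((ap N a j)%:R : R).
Local Notation z := (zsum (R := R) N a).

(* [1 / (m (m - u))] for [m = a + N j] *)
Definition geom (j : nat) : fps3 R := FPS (fun i => fpsC (fpsC ((m j)^-1 ^+ i.+2))).

Lemma coef_geomM j f p q r :
  (geom j * f) p q r = \sum_(i < p.+1) (m j)^-1 ^+ i.+2 * f (p - i)%N q r.
Proof.
rewrite fps_coefM !fps_coef_sum; apply: eq_bigr => i _.
by rewrite !fps_coefCM.
Qed.

(** Generating function of all indices, admissible or not: v marks the entries 1 and w the others,
    whence depth q + r. By [inner_gen0] and [inner_genS] it is the product over m below [ap J]. *)
Definition inner_gen (J : nat) : fps3 R :=
  FPS3 (fun p q r => \sum_(ks <- indices (q + r) p r) z J ks).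

Definition trunc_gen (J : nat) : fps3 R :=
  FPS3 (fun p q r => \sum_(ks <- admissible_indices p q r) z J ks).

(** The contribution of the tuples with m_1 = [ap J]. *)
Definition layer_gen (J : nat) : fps3 R := geom J * inner_gen J.

Definition genfun : fps3 R :=
  FPS3 (fun p q r => \sum_(ks <- admissible_indices p q r) t_value N a ks).

(** The added chains start with [ap J], paired with the head i + 2; summing over i is a convolution
    with the coefficients of [geom J]. *)
Lemma sum_cons_ge2 J F p :
  \sum_(ks <- cons_ge2 F p) z J.+1 ks = \sum_(ks <- cons_ge2 F p) z J ks
    + \sum_(i < p.+1) (m J)^-1 ^+ i.+2 * \sum_(ks <- F (p - i)%N) z J ks.
Proof.
rewrite /cons_ge2 !big_allpairs_dep.
rewrite -[iota 0 p.+1]/(index_iota 0 p.+1) !big_mkord -big_split /=.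
apply: eq_bigr => i _; rewrite mulr_sumr -big_split /=.
by apply: eq_bigr => ks _; rewrite zsumS.
Qed.

Lemma indices_height_gt n p r : (n < r)%N -> indices n p r = [::].
Proof.
move=> nr; case e: (indices n p r) => [//|ks s].
have : ks \in indices n p r by rewrite e inE eqxx.
rewrite mem_indices => /and4P[_ /eqP sz /eqP h _].
by have := count_size (leq 2) ks; rewrite -/(height ks); lia.
Qed.

Lemma inner_gen0 : inner_gen 0 = 1.
Proof.
apply: fps3P => p q r; rewrite /inner_gen /=.
rewrite [RHS]coef3_1.
case: ifP => [/and3P[/eqP -> /eqP -> /eqP ->]|nz].
  by rewrite big_seq1 zsum_nil.
rewrite big_seq big1 // => -[|k ks]; last by rewrite zsum0_cons.
by rewrite mem_indices /height /=; lia.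
Qed.

(** The three terms of the factor correspond to [ap J] being absent, paired with an entry 1, or
    paired with an entry at least 2. *)
Lemma inner_genS J : inner_gen J.+1 = inner_gen J * (1 + cst3 (m J)^-1 * fpsV + fpsW * geom J).
Proof.
apply: fps3P => p q r; rewrite coef_M1VW.
have indS n : \sum_(ks <- indices n.+1 p r) z J.+1 ks = \sum_(ks <- indices n.+1 p r) z J ks
    + (m J)^-1 * (\sum_(ks <- indices n p r) z J ks)
    + (if r is r'.+1 then
         \sum_(i < p.+1) (m J)^-1 ^+ i.+2 * \sum_(ks <- indices n (p - i) r') z J ks else 0).
  rewrite /= !big_cat !big_map /=.
  rewrite (eq_bigr (fun ks => z J (1%N :: ks) + (m J)^-1 * z J ks)); last first.
    by move=> ks _; rewrite zsumS expr1.
  rewrite big_split -mulr_sumr /=; case: r => [|r]; first by rewrite !big_nil !addr0.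
  by rewrite sum_cons_ge2; ring.
rewrite [inner_gen J.+1 p q r]/= [inner_gen J p q r]/=.
(* [indS] needs positive depth q + r, so q = r = 0 is separate. For q = 0 < r there is no v term,
   and the matching sum in [indS] is empty because its height exceeds its depth. *)
case: q r indS => [|q] [|r] indS.
- rewrite /= mulr0 !addr0; case: eqP => _; last by rewrite !big_nil.
  by rewrite !big_seq1 !zsum_nil.
- by rewrite add0n indS (indices_height_gt p (ltnSn r)) big_nil coef_geomM.
- by rewrite addSn indS.
rewrite addSn indS coef_geomM; congr (_ + _); apply: eq_bigr => i _.
by rewrite -addSnnS.
Qed.

Lemma trunc_gen0 : trunc_gen 0 = 0.
Proof.
apply: fps3P => p q r; rewrite /trunc_gen [LHS]/= big_seq big1 // => -[|k ks _].
  by move/negP: (nil_cons_ge2 (fun p => indices (q + r) p r) p).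
by rewrite zsum0_cons.
Qed.

Lemma trunc_genS J : trunc_gen J.+1 = trunc_gen J + layer_gen J.
Proof. by apply: fps3P => p q r; rewrite coef3D coef_geomM -sum_cons_ge2. Qed.

(** Under the summation constraints the subtractions are exact, so (k, n, s) is recovered from the
    exponents and at most one monomial contributes. *)
Lemma genfun_wtE k p q r : genfun_wt N a k p q r =
  if k == (p + q + 2 * r + 2)%N then genfun p q r else 0.
Proof.
pose k0 := (p + q + 2 * r + 2)%N.
rewrite /genfun_wt !fps_coef_sum.
have E s n : (1 <= s)%N -> (s <= n)%N -> (n + s <= k)%N ->
   (cst3 (G0 N a k n s) * fpsU ^+ (k - n - s) * fpsV ^+ (n - s) * fpsW ^+ (s - 1)) p q r
   = if [&& k == k0, s == r.+1 & n == (q + r).+1] then genfun p q r else 0.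
  move=> s1 sn nk; rewrite coef_monomial.
  have -> : [&& p == k - n - s, q == n - s & r == s - 1]%N =
            [&& k == k0, s == r.+1 & n == (q + r).+1].
    by apply/idP/idP; rewrite /k0; lia.
  case: ifP => // /and3P[/eqP -> /eqP -> /eqP ->].
  by rewrite /k0 -[(q + r).+1]addn1 -[r.+1]addn1 G0E.
rewrite -/k0; have [ek|nk] := eqVneq k k0; last first.
  rewrite big_nat big1 // => s /andP[s1 _]; rewrite !fps_coef_sum.
  rewrite big_nat_cond big1 // => n /andP[/andP[sn _] nsk].
  by rewrite E // (negPf nk).
rewrite (bigD1_seq r.+1) ?iota_uniq ?mem_index_iota //=; last by rewrite ek /k0; lia.
rewrite [X in _ + X]big_nat_cond [X in _ + X]big1 ?addr0; last first.
  move=> s /andP[/andP[s1 _] sr]; rewrite !fps_coef_sum.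
  rewrite big_nat_cond big1 // => n /andP[/andP[sn _] nsk].
  by rewrite E // (negPf sr) /= andbF.
rewrite !fps_coef_sum big_mkcond (bigD1_seq (q + r).+1) ?iota_uniq //=; last first.
  by rewrite mem_index_iota ek /k0; lia.
rewrite [X in _ + X]big_nat_cond [X in _ + X]big1 ?addr0; last first.
  move=> n /andP[/andP[sn _] nr]; case: ifP => // nsk.
  by rewrite E // (negPf nr) !andbF.
rewrite ifT; last by rewrite ek /k0; lia.
by rewrite E ?ek ?eqxx // /k0; lia.
Qed.

(** Only one weight contributes to a given coefficient, so its partial sums are eventually
    constant. *)
Lemma coefwise_sum_genfun_wt : coefwise_sum (fun k => genfun_wt N a k) genfun.
Proof.
move=> p q r; apply: cvg_near_cst; near=> n.
rewrite (eq_bigr (fun k : 'I_n =>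
  if (k : nat) == (p + q + 2 * r + 2)%N then genfun p q r else 0)); last first.
  by move=> k _; rewrite genfun_wtE.
move: (genfun p q r) => g.
have lt_n : (p + q + 2 * r + 2 < n)%N by near: n; exact: nbhs_infty_gt.
rewrite (bigD1 (Ordinal lt_n)) //= eqxx big1 ?addr0 // => i.
by rewrite -val_eqE /= => /negPf ->.
Unshelve. all: by end_near. Qed.

Hypothesis a_ge1 : (1 <= a)%N.

Let m_neq0 j : m j != 0.
Proof. by rewrite pnatr_eq0 -lt0n addn_gt0 a_ge1. Qed.

(** Geometric series: multiplication by m - u cancels all coefficients but the one at u^0. *)
Lemma geomK j : geom j * ((ap N a j)%:R * ((ap N a j)%:R - fpsU)) = 1.
Proof.
rewrite cst3_natr mulrC -mulrA.
have gE p q r : (geom j) p q r = if (q == 0%N) && (r == 0%N) then (m j)^-1 ^+ p.+2 else 0.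
  by rewrite /geom /=; case: q r => [|q] [|r].
apply: fps3P => p q r; rewrite [RHS]coef3_1 coef_cst3M coef_cst3BUM.
rewrite gE; case: p => [|p]; rewrite ?gE; case: (_ && _);
  rewrite ?andbF ?mulr0 ?subrr ?mulr0 ?subr0 ?mulr0 //=.
  by rewrite expr2 mulVKf // divff.
by rewrite [_ ^+ p.+3]exprS mulVKf // subrr mulr0.
Qed.

Hypothesis a_leN : (a <= N)%N.

(** The partial sums of the layers are the truncations [trunc_gen], whose coefficients are finite
    sums of convergent [zsum]. *)
Lemma coefwise_sum_layer_gen : coefwise_sum layer_gen genfun.
Proof.
move=> p q r.
have E n : \sum_(j < n) layer_gen j p q r = trunc_gen n p q r.
  elim: n => [|n IH]; first by rewrite trunc_gen0 big_ord0.
  by rewrite trunc_genS coef3D -IH big_ord_recr.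
under eq_fun do rewrite E [trunc_gen _ _ _ _]/= big_seq.
rewrite [genfun p q r]/= big_seq.
apply: cvg_big => [|ks ksI]; first exact: add_continuous.
by apply: cvg_zsum => //; have [] := (mem_admissible_indices _ _ _ _).1 ksI.
Qed.
End GeneratingFunction.

(** * Pochhammer symbols and the recursion for hypergeometric terms *)

Lemma poch0 (A : comUnitRingType) (b : A) : poch b 0 = 1.
Proof. by rewrite /poch big_ord0. Qed.

Lemma pochS (A : comUnitRingType) (b : A) j : poch b j.+1 = poch b j * (b + j%:R).
Proof. by rewrite /poch big_ord_recr. Qed.

Lemma poch1 (A : comUnitRingType) j : poch (1 : A) j = j`!%:R.
Proof.
elim: j => [|j IH]; first by rewrite poch0.
by rewrite pochS IH factS mulnC natrM -nat1r.
Qed.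

Lemma rmorph_poch (A B : comUnitRingType) (f : {rmorphism A -> B}) c j :
  f (poch c j) = poch (f c) j.
Proof. by rewrite rmorph_prod; apply: eq_bigr => i _; rewrite rmorphD rmorph_nat. Qed.

(* The recursion is the termwise ratio of the hypergeometric series with
   numerator parameters [alpha], [beta], both sides being scaled by [n ^ 2]. *)
Lemma hyper_term_rec (S A : comUnitRingType) (iota : {rmorphism S -> A})
    (T : nat -> S) (x n u v w : S) (alpha beta : A) :
    n \is a GRing.unit ->
    (forall j, j.+1%:R \is a @GRing.unit S) ->
    (forall j, x + n * j.+1%:R \is a GRing.unit) ->
    (forall j, x + n * j.+1%:R - u \is a GRing.unit) ->
    T 0 = 1 ->
    (forall j, T j.+1 * ((x + n * j.+1%:R) * (x + n * j.+1%:R - u)) =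
       T j * ((x + n * j%:R) * (x + n * j%:R - u) + v * (x + n * j%:R - u) + w)) ->
    alpha + beta = iota (n^-1 * (2 * x - u + v)) ->
    alpha * beta = iota ((n ^+ 2)^-1 * (x * (x - u + v) - u * v + w)) ->
  forall j, iota (T j) = hyper_term [:: alpha; beta; 1]
    [:: iota ((x + n) / n); iota ((x + n - u) / n)] 1 j.
Proof.
move=> nU natU xU xuU T0 TS sum_ab prod_ab j.
(* Factors of the lower Pochhammer symbols; u' = u and u' = 0 give the two parameters. *)
have lin l u' : (x + n - u') / n + l%:R = (x + n * l.+1%:R - u') / n.
  transitivity ((x + n - u') / n + l%:R * (n / n)); first by rewrite divrr ?mulr1.
  by rewrite -nat1r; ring.
have pochU u' : (forall l, x + n * l.+1%:R - u' \is a GRing.unit) ->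
    poch ((x + n - u') / n) j \is a GRing.unit.
  by move=> xU'; apply: rpred_prod => l _; rewrite lin unitrM xU' unitrV.
have lin0 l : (x + n) / n + l%:R = (x + n * l.+1%:R) / n.
  by have := lin l 0; rewrite !subr0.
have poch0U : poch ((x + n) / n) j \is a GRing.unit.
  by rewrite -[x + n]subr0; apply: pochU => l; rewrite subr0.
have natfU : j`!%:R \is a @GRing.unit S.
  elim: (j) => [|i IH]; first by rewrite unitr1.
  by rewrite factS natrM unitrM natU.
(* The product (l + alpha)(l + beta) is symmetric in the two roots, hence lies in the image of
   [iota]. *)
have num l : iota (n^-1 ^+ 2 * ((x + n * l%:R) * (x + n * l%:R - u)
      + v * (x + n * l%:R - u) + w)) = (alpha + l%:R) * (beta + l%:R).
  transitivity (alpha * beta + l%:R * (alpha + beta) + l%:R ^+ 2); last by ring.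
  rewrite sum_ab prod_ab -(rmorph_nat iota l) -rmorphXn -!rmorphM -!rmorphD.
  congr (iota _); rewrite -exprVn; move: (divrr nU); move: n^-1 => i ni.
  transitivity (i ^+ 2 * (x * (x - u + v) - u * v + w)
    + l%:R * (n * i) * (i * (2 * x - u + v)) + l%:R ^+ 2 * (n * i) ^+ 2); first by ring.
  by rewrite ni expr1n !mulr1.
(* The ratio is proved with denominators cleared; they are units already in [S], so the division is
   carried out there afterwards. *)
have key : iota (T j * (poch ((x + n) / n) j * poch ((x + n - u) / n) j)) =
    poch alpha j * poch beta j.
  elim: (j) => [|i IH]; first by rewrite !poch0 T0 !mulr1 rmorph1.
  rewrite !pochS lin lin0 [RHS]mulrACA -IH -num -rmorphM; congr (iota _).
  move: (poch _ i) (poch _ i) (TS i) => p q E.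
  transitivity (n^-1 ^+ 2 * (T i.+1 * ((x + n * i.+1%:R) * (x + n * i.+1%:R - u))) * (p * q)).
    by ring.
  by rewrite E; ring.
(* The upper parameter 1 gives (1)_j = j!, which cancels the j! of the series. *)
rewrite /hyper_term !big_cons !big_nil !mulr1 expr1n poch1.
rewrite -!rmorph_poch [poch alpha j * _]mulrA -key -(rmorph_nat iota).
set y := poch _ j * poch _ j; set f : S := j`!%:R.
rewrite -[iota _ * iota (poch _ j)]rmorphM -/y -rmorphV ?unitrM ?poch0U ?pochU //.
rewrite mul1r -rmorphV // -!rmorphM; congr (iota _).
have yU : y \is a GRing.unit by rewrite unitrM poch0U pochU.
by rewrite mulrAC mulrK // mulrK.
Qed.

(** * The layers as hypergeometric terms *)

Section HypergeometricTerms.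
Context {R : realType} (N a : nat).
Hypothesis a_ge1 : (1 <= a)%N.

Local Notation mm j := ((ap N a j)%:R : fps3 R).
Local Notation D j := (mm j * (mm j - fpsU)).

(** The layer normalized by its value 1/(a(a-u)) at j = 0; this is the hypergeometric term, as a
    power series. *)
Definition hyper_coef (j : nat) : fps3 R := a%:R * (a%:R - fpsU) * layer_gen N a j.

Lemma mm_unit j : mm j \is a GRing.unit.
Proof. by apply: natr_fps3_unit; rewrite addn_gt0 a_ge1. Qed.

Lemma D_unit j : D j \is a GRing.unit.
Proof. by apply/unitrPr; exists (geom N a j); rewrite mulrC geomK. Qed.

Lemma mmU_unit j : mm j - fpsU \is a GRing.unit.
Proof. by have := D_unit j; rewrite unitrM => /andP[]. Qed.

Lemma mmE j : mm j = a%:R + N%:R * j%:R.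
Proof. by rewrite /ap natrD natrM. Qed.

Lemma hyper_coef0 : hyper_coef 0 = 1.
Proof.
have g := geomK (R := R) N a_ge1 0; rewrite /ap muln0 addn0 in g.
by rewrite /hyper_coef /layer_gen inner_gen0 mulr1 mulrC.
Qed.

Lemma hyper_coefM j : hyper_coef j * D j = a%:R * (a%:R - fpsU) * inner_gen N a j.
Proof.
have g := geomK (R := R) N a_ge1 j.
rewrite /hyper_coef /layer_gen.
move: (a%:R * _) (inner_gen _ _ _) (geom _ _ _) (D _) g => x e h d hd.
by rewrite -mulrA [h * e]mulrC -mulrA hd mulr1.
Qed.

(** After multiplication by the unit [D j], this is [inner_genS] with 1 + v/m + w/(m(m-u)) brought
    over the denominator m(m-u). *)
Lemma hyper_coefS j :
  hyper_coef j.+1 * D j.+1 = hyper_coef j * (D j + fpsV * (mm j - fpsU) + fpsW).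
Proof.
apply: (mulIr (D_unit j)); rewrite hyper_coefM inner_genS.
have g := geomK (R := R) N a_ge1 j.
have c : cst3 ((ap N a j)%:R^-1 : R) * mm j = 1.
  by rewrite cst3_natr /cst3 -!rmorphM /= mulVf ?rmorph1 // pnatr_eq0 -lt0n addn_gt0 a_ge1.
rewrite [RHS]mulrAC hyper_coefM.
move: (cst3 _) c (geom _ _ _) g (a%:R * _) (inner_gen _ _ _).
move: (mm j) fpsU fpsV fpsW => M u v w c cM h hM A e.
transitivity (A * e * (M * (M - u) + (c * M) * v * (M - u) + (h * (M * (M - u))) * w)).
  by ring.
by rewrite cM hM !mul1r.
Qed.
End HypergeometricTerms.

Theorem theorem2p1 (R : realType) (N a : nat)
  (N_gt0 : (0 < N)%N) (a_ge1 : (1 <= a)%N) (a_leN : (a <= N)%N)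
  (A : comUnitRingType) (iota : {rmorphism fps3 R -> A})
  (iota_inj : injective iota) (alpha beta : A)
  (sum_alpha_beta : alpha + beta =
     iota (N%:R^-1 * (2 * a%:R - fpsU + fpsV)))
  (prod_alpha_beta : alpha * beta =
     iota ((N%:R ^+ 2)^-1
           * (a%:R * (a%:R - fpsU + fpsV) - fpsU * fpsV + fpsW))) :
  exists (T : nat -> fps3 R) (F32 : fps3 R),
    [/\ forall j : nat, iota (T j) =
          hyper_term [:: alpha; beta; 1]
            [:: iota ((a%:R + N%:R) / N%:R);
                iota ((a%:R + N%:R - fpsU) / N%:R)] 1 j,
        coefwise_sum T F32
      & coefwise_sum (fun k : nat => genfun_wt N a k)
          ((a%:R * (a%:R - fpsU))^-1 * F32)].
Proof.
exists (hyper_coef N a), (a%:R * (a%:R - fpsU) * genfun N a); split.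
- apply: (hyper_term_rec _ _ _ _ _ _ sum_alpha_beta prod_alpha_beta).
  + exact: natr_fps3_unit.
  + by move=> j; apply: natr_fps3_unit.
  + by move=> j; rewrite -mmE; apply: mm_unit.
  + by move=> j; rewrite -mmE; apply: mmU_unit.
  + exact: hyper_coef0.
  + by move=> j; rewrite -!mmE; apply: hyper_coefS.
- by apply: coefwise_sumMl; apply: coefwise_sum_layer_gen.
(* The prefactor a(a-u) is [D 0], a unit, so it cancels and leaves [genfun]. *)
- rewrite mulKr; first exact: coefwise_sum_genfun_wt.
  by have := D_unit (R := R) N a_ge1 0; rewrite mmE mulr0 addr0.
Qed.
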